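(* Let $n\ge 3$ be odd, and let $(W_{n+1},\sigma)$ be the signed graph whose underlying graph is the wheel $W_{n+1}=C_n\vee K_1$ and whose signature is $\sigma(e)=-1$ if $e\in E(C_n)$ and $\sigma(e)=1$ otherwise. Then the spectrum of $D^{\pm}(W_{n+1},\sigma)$, counted with multiplicity, consists of the two eigenvalues $$n-4+\sqrt{n^2-7n+16}\quad\text{and}\quad n-4-\sqrt{n^2-7n+16},$$ each with multiplicity $1$, together with, for each $j=1,2,\ldots,n-1$, the eigenvalue $$-2-6\cos\frac{2j\pi}{n}$$ with multiplicity $1$.
   Context: The wheel $C_n\vee K_1$ is the cycle $C_n$ together with one further vertex adjacent to all vertices of $C_n$. A signed graph $\Sigma=(G,\sigma)$ consists of an underlying graph $G=(V,E)$ and a signature $\sigma:E\to\{1,-1\}$. The sign of a path is the product of the signs of its edges. Let $d(u,v)$ be the usual graph distance in $G$ (connected). For vertices $u,v$, let $\sigma_{\max}(u,v)=-1$ if all shortest $uv$-paths have sign $-1$, and $+1$ otherwise; let $\sigma_{\min}(u,v)=+1$ if all shortest $uv$-paths have sign $+1$, and $-1$ otherwise. The signed distance matrices are $D^{\max}(\Sigma)=(\sigma_{\max}(u,v)d(u,v))$ and $D^{\min}(\Sigma)=(\sigma_{\min}(u,v)d(u,v))$; when they are equal, the common matrix is denoted $D^{\pm}(\Sigma)$. For the signed wheel considered here $D^{\max}=D^{\min}$, so $D^{\pm}$ is defined. Eigenvalues for different values of $j$ are listed separately; if listed values coincide, their multiplicities add. *)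

(* Defs.v *)
From HB Require Import structures.
From mathcomp Require Import all_boot all_order all_algebra.
From mathcomp Require Import all_classical all_reals all_analysis.

Set Implicit Arguments.
Unset Strict Implicit.
Unset Printing Implicit Defensive.

Import Order.TTheory GRing.Theory Num.Theory.
Local Open Scope ring_scope.

(* The values of [sign] on non-adjacent pairs are irrelevant. *)
Record signed_graph (T : finType) := SignedGraph {
  adj : rel T;
  adj_sym : symmetric adj;
  adj_irr : irreflexive adj;
  adj_connected : forall u v, connect adj u v;
  sign : T -> T -> int;
  sign_sym : forall u v, adj u v -> sign u v = sign v u;
  sign_pm1 : forall u v, adj u v -> sign u v = 1 \/ sign u v = -1
}.

Section SignedDistance.
Variables (T : finType) (S : signed_graph T).

(* The path u = x_0, x_1, ..., x_k = v is encoded by its start u and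
   p = [:: x_1; ...; x_k]; its length is size p. *)
Definition is_path (u v : T) (p : seq T) : bool :=
  [&& path (adj S) u p, last u p == v & uniq (u :: p)].

Definition path_sign (u : T) (p : seq T) : int :=
  \prod_(e <- zip (u :: p) p) sign S e.1 e.2.

Definition has_path_of_length (u v : T) (k : nat) : bool :=
  [exists p : k.-tuple T, is_path u v p].

Lemma ex_path_length (u v : T) : exists k, has_path_of_length u v k.
Proof.
have /connectP [p pp ->] := adj_connected S u v.
case: (shortenP pp) => q pq uq _; exists (size q).
by apply/existsP; exists (in_tuple q); rewrite /is_path pq eqxx uq.
Qed.

Definition dist (u v : T) : nat := ex_minn (ex_path_length u v).

Definition all_shortest_paths_have_sign (s : int) (u v : T) : bool :=
  [forall p : (dist u v).-tuple T, is_path u v p ==> (path_sign u p == s)].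

Definition sigma_max (u v : T) : int :=
  if all_shortest_paths_have_sign (-1) u v then -1 else 1.

Definition sigma_min (u v : T) : int :=
  if all_shortest_paths_have_sign 1 u v then 1 else -1.

End SignedDistance.

Definition Dmax (R : realType) (N : nat) (S : signed_graph 'I_N) : 'M[R]_N :=
  \matrix_(u, v) (sigma_max S u v * (dist S u v)%:Z)%:~R.

Definition Dmin (R : realType) (N : nat) (S : signed_graph 'I_N) : 'M[R]_N :=
  \matrix_(u, v) (sigma_min S u v * (dist S u v)%:Z)%:~R.

(* Only meaningful when Dmax R S = Dmin R S. *)
Definition Dpm (R : realType) (N : nat) (S : signed_graph 'I_N) : 'M[R]_N :=
  Dmax R S.

(* The list s, read as a multiset, is the spectrum of A: the characteristic
   polynomial splits over R and its roots, with multiplicity, are s. *)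
Definition has_spectrum (R : realType) (N : nat) (A : 'M[R]_N) (s : seq R) :
    Prop :=
  char_poly A = \prod_(a <- s) ('X - a%:P).

(* Vertices of C_n are 'I_n, with ordS the cyclic successor; [i != j] only
   matters for n = 1. *)
Definition cycle_adj (n : nat) : rel 'I_n :=
  fun i j => (i != j) && ((j == ordS i) || (i == ordS j)).

(* The wheel has vertex set 'I_n.+1: the vertex ord0 is the hub, and lift ord0 i
   is the vertex i of C_n. *)
Definition rim_edge (n : nat) : rel 'I_n.+1 :=
  fun u v => match unlift ord0 u, unlift ord0 v with
             | Some i, Some j => cycle_adj i j
             | _, _ => false
             end.

Definition spoke (n : nat) : rel 'I_n.+1 :=
  fun u v => (u == ord0) (+) (v == ord0).

Definition wheel_adj (n : nat) : rel 'I_n.+1 :=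
  fun u v => rim_edge u v || spoke u v.

Definition wheel_sign (n : nat) (u v : 'I_n.+1) : int :=
  if rim_edge u v then -1 else 1.

Lemma rim_edge_sym (n : nat) : symmetric (@rim_edge n).
Proof.
move=> u v; rewrite /rim_edge.
case: (unlift ord0 u) => [i|]; case: (unlift ord0 v) => [j|] //.
by rewrite /cycle_adj eq_sym orbC.
Qed.

Lemma wheel_adj_sym (n : nat) : symmetric (@wheel_adj n).
Proof. by move=> u v; rewrite /wheel_adj rim_edge_sym /spoke addbC. Qed.

Lemma wheel_adj_irr (n : nat) : irreflexive (@wheel_adj n).
Proof.
move=> u; rewrite /wheel_adj /spoke addbb orbF /rim_edge.
by case: (unlift ord0 u) => // i; rewrite /cycle_adj eqxx.
Qed.

Lemma wheel_adj_connected (n : nat) (u v : 'I_n.+1) :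
  connect (@wheel_adj n) u v.
Proof.
have hub w : connect (@wheel_adj n) w ord0.
  have [->//|w0] := eqVneq w ord0.
  by apply: connect1; rewrite /wheel_adj /spoke (negPf w0) eqxx orbT.
apply: connect_trans (hub u) _.
by rewrite (sym_connect_sym (@wheel_adj_sym n)).
Qed.

Lemma wheel_sign_sym (n : nat) (u v : 'I_n.+1) :
  wheel_adj u v -> wheel_sign u v = wheel_sign v u.
Proof. by rewrite /wheel_sign rim_edge_sym. Qed.

Lemma wheel_sign_pm1 (n : nat) (u v : 'I_n.+1) :
  wheel_adj u v -> wheel_sign u v = 1 \/ wheel_sign u v = -1.
Proof. by rewrite /wheel_sign; case: ifP; [right | left]. Qed.

Definition signed_wheel (n : nat) : signed_graph 'I_n.+1 :=
  SignedGraph (@wheel_adj_sym n) (@wheel_adj_irr n) (@wheel_adj_connected n)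
    (@wheel_sign_sym n) (@wheel_sign_pm1 n).

(* Main.v *)
Require Import Defs.
From HB Require Import structures.
From mathcomp Require Import all_boot all_order all_algebra.
From mathcomp Require Import all_classical all_reals all_analysis.
From mathcomp Require Import ring lra zify.

Import Order.TTheory GRing.Theory Num.Theory.
Local Open Scope ring_scope.

(** Write J for the all-ones matrix and A for the adjacency matrix of the rim
    cycle. Two adjacent vertices have a single shortest path, the edge itself.
    Two non-adjacent rim vertices are at distance 2, and a shortest path between
    them uses either two spokes or two rim edges, so its sign is always +1
    ([wheel_signed_distance]). Hence both signed distance matrices are

      D = [ 0   1^T            ]
          [ 1   2 J - 2 I - 3 A ].

    The block on the rim is circulant, so it is diagonalised by a Fourier
    basis. To remain over the reals the characters of Z/n are replaced by the
    Hartley vectors v_j(k) = cas(2 pi j k / n), where cas = cos + sin. They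
    satisfy A v_j = 2 cos(2 pi j / n) v_j ([hartley_row_neighbors]), they are
    pairwise orthogonal of square norm n ([hartley_orthogonal]), and v_0 is the
    constant vector 1. For 0 < j < n, v_j is orthogonal to 1, so (0, v_j) is an
    eigenvector of D with eigenvalue -2 - 6 cos(2 pi j / n). On the remaining
    invariant plane, spanned by the hub and 1, the vector (n, x 1) is an
    eigenvector with eigenvalue x exactly when x^2 = (2n - 8) x + n, that is
    for x = n - 4 +- sqrt(n^2 - 7n + 16).

    These n + 1 rows are pairwise orthogonal: the two special ones have inner
    product n^2 + n x x', which vanishes because the roots have product -n.
    A matrix with nonzero pairwise orthogonal rows is invertible, so D is
    similar to the diagonal matrix of the listed eigenvalues, and its
    characteristic polynomial is as claimed
    ([char_poly_orthogonal_eigenrows]). *)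

(** * Characteristic polynomial from orthogonal eigenvectors *)

(** The Gram matrix P P^T is diagonal with nonzero diagonal, so P is
    invertible and conjugates A to the diagonal matrix of d. Invertibility is
    used only through the determinant, which can be cancelled in F[X]. *)
Lemma char_poly_orthogonal_eigenrows (F : fieldType) (n : nat)
    (P A : 'M[F]_n) (d : 'rV[F]_n) :
  P *m A = diag_mx d *m P ->
  (forall i j, i != j -> (P *m P^T) i j = 0) ->
  (forall i, (P *m P^T) i i != 0) ->
  char_poly A = \prod_i ('X - (d 0 i)%:P).
Proof.
move=> PA offdiag diag.
have detP : \det P != 0.
  have : \det (P *m P^T) != 0.
    rewrite det_trig; first by apply/prodf_neq0 => i _; exact: diag.
    by apply/is_trig_mxP => i j lt_ij; rewrite offdiag// -val_eqE ltn_eqF.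
  by rewrite det_mulmx det_tr mulf_eq0 orbb.
have -> : \prod_i ('X - (d 0 i)%:P) = char_poly (diag_mx d).
  rewrite char_poly_trig ?diag_mx_is_trig//.
  by apply: eq_bigr => i _; rewrite !mxE eqxx mulr1n.
have detP' : \det (map_mx polyC P) != 0 by rewrite det_map_mx polyC_eq0.
apply: (mulfI detP'); rewrite /char_poly -det_mulmx mulrC -det_mulmx.
congr (\det _); rewrite /char_poly_mx mulmxBr mulmxBl -!map_mxM PA.
by rewrite scalar_mxC.
Qed.

(** * Distances and signs of shortest paths *)

Section Distance.
Variables (T : finType) (S : signed_graph T).
Implicit Types (u v w : T) (p : seq T) (s : int).

Lemma dist_le_size u v p : is_path S u v p -> (dist S u v <= size p)%N.
Proof.
move=> pp; rewrite /dist; case: ex_minnP => k _; apply.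
by apply/existsP; exists (in_tuple p).
Qed.

Lemma shortest_path_exists u v :
  exists p : (dist S u v).-tuple T, is_path S u v p.
Proof.
by rewrite /dist; case: ex_minnP => k /existsP[p pp] _; exists p.
Qed.

Lemma dist_diag u : dist S u u = 0.
Proof.
have := @dist_le_size u u [::]; rewrite /is_path /= eqxx leqn0.
by move=> /(_ isT)/eqP.
Qed.

Lemma dist_adj u v : adj S u v -> dist S u v = 1.
Proof.
move=> uv; have neq_uv : u != v.
  by apply: contraTneq uv => ->; rewrite adj_irr.
apply/eqP; rewrite eqn_leq (@dist_le_size u v [:: v]); last first.
  by rewrite /is_path /= uv eqxx inE neq_uv.
have [p pp] := shortest_path_exists u v.
rewrite lt0n; apply: contra neq_uv => /eqP d0.
move: pp; case: p => -[|x p] /=; rewrite d0// => _.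
by rewrite /is_path /= andbT.
Qed.

Lemma dist_common_neighbor u v w :
  u != v -> ~~ adj S u v -> adj S u w -> adj S w v -> dist S u v = 2.
Proof.
move=> neq_uv nuv uw wv.
have neq_uw : u != w by apply: contraTneq uw => ->; rewrite adj_irr.
have neq_wv : w != v by apply: contraTneq wv => ->; rewrite adj_irr.
apply/eqP; rewrite eqn_leq (@dist_le_size u v [:: w; v]); last first.
  by rewrite /is_path /= uw wv eqxx !inE negb_or neq_uw neq_uv neq_wv.
have [[p /= /eqP sp] pp] := shortest_path_exists u v.
rewrite ltnNge -sp; apply/negP; case: p pp {sp} => [|x [|y p]]//=.
  by rewrite /is_path /= andbT (negPf neq_uv).
rewrite /is_path /= andbT => /and3P[ux /eqP xv _] _.
by rewrite -xv ux in nuv.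
Qed.

(** The existence of a shortest path matters here: with no path at all, both
    signs would be vacuously uniform and the two functions would differ. *)
Lemma sigma_of_uniform_sign s u v : s = 1 \/ s = -1 ->
  (forall p, is_path S u v p -> size p = dist S u v -> path_sign S u p = s) ->
  sigma_max S u v = s /\ sigma_min S u v = s.
Proof.
move=> s_pm1 sgn.
have allE t : all_shortest_paths_have_sign S t u v = (s == t).
  apply/forallP/eqP => [|<- p]; last first.
    by apply/implyP => pp; rewrite sgn ?size_tuple.
  have [p pp] := shortest_path_exists u v.
  by move=> /(_ p); rewrite pp sgn ?size_tuple// => /eqP.
by rewrite /sigma_max /sigma_min !allE; case: s_pm1 => ->.
Qed.

End Distance.

(** * The signed distance matrix of the wheel *)

Section WheelDistance.
Variable n : nat.
Implicit Types (u v w : 'I_n.+1) (i j : 'I_n).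

Definition signed_wheel_distance u v : int :=
  if u == v then 0 else if rim_edge u v then -1 else if spoke u v then 1 else 2.

Lemma rim_edge0r u : rim_edge u ord0 = false.
Proof. by rewrite /rim_edge unlift_none; case: unlift. Qed.

Lemma wheel_signed_distance u v :
  sigma_max (signed_wheel n) u v * (dist (signed_wheel n) u v)%:Z
    = signed_wheel_distance u v /\
  sigma_min (signed_wheel n) u v * (dist (signed_wheel n) u v)%:Z
    = signed_wheel_distance u v.
Proof.
rewrite /signed_wheel_distance; have [<-|neq_uv] := eqVneq.
  by rewrite dist_diag !mulr0.
have [uv|nuv] := boolP (wheel_adj u v).
  have d1 : dist (signed_wheel n) u v = 1 by exact: dist_adj.
  have [||-> ->] := @sigma_of_uniform_sign _ (signed_wheel n) (wheel_sign u v) u v.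
  - by have [] := wheel_sign_pm1 uv; [left|right].
  - rewrite d1 => -[|x [|y p]]//; rewrite /is_path /= => /and3P[_ /eqP-> _] _.
    by rewrite /path_sign /= big_seq1.
  rewrite d1 !mulr1 /wheel_sign; case: ifP => // nrim.
  by move: uv; rewrite /wheel_adj nrim /= => ->.
have [nrim nspoke] : rim_edge u v = false /\ spoke u v = false.
  by move: nuv; rewrite /wheel_adj negb_or => /andP[/negPf ? /negPf].
(* Neither endpoint is the hub, so the hub is a common neighbour. *)
have [u0 v0] : u != ord0 /\ v != ord0.
  move: nspoke neq_uv; rewrite /spoke.
  by have [->|_] := eqVneq u ord0; case: (eqVneq v ord0).
have hub x : x != ord0 -> wheel_adj x ord0.
  by move=> x0; rewrite /wheel_adj /spoke (negPf x0) eqxx orbT.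
have d2 : dist (signed_wheel n) u v = 2.
  apply: (@dist_common_neighbor _ _ u v ord0) => //=; first exact: hub.
  by rewrite wheel_adj_sym; exact: hub.
have [||-> ->] := @sigma_of_uniform_sign _ (signed_wheel n) 1 u v; [by left| |].
  rewrite d2 => -[|w [|x [|y p]]]//.
  rewrite /is_path /= => /and3P[/and3P[uw wx _] /eqP xv _] _.
  rewrite /path_sign /= big_cons big_seq1 /= {}xv in wx *.
  move: uw wx; rewrite /wheel_sign /wheel_adj /spoke (negPf u0) (negPf v0).
  (* The middle vertex is either the hub (two spokes) or on the rim (two
     negative edges). *)
  have [->|_] := eqVneq w ord0.
    by rewrite (rim_edge_sym ord0) !rim_edge0r.
  by rewrite !orbF => -> ->.
by rewrite nrim nspoke d2 !mul1r.
Qed.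

Lemma signed_wheel_distance_hub_rim i :
  signed_wheel_distance ord0 (lift ord0 i) = 1.
Proof.
by rewrite /signed_wheel_distance rim_edge_sym rim_edge0r /spoke eqxx.
Qed.

Lemma signed_wheel_distance_rim_hub i :
  signed_wheel_distance (lift ord0 i) ord0 = 1.
Proof. by rewrite /signed_wheel_distance rim_edge0r /spoke eqxx. Qed.

(** The rim block is 2 J - 2 I - 3 A. The adjacency matrix A of the cycle splits
    as the sum of the two cyclic shifts because, for n >= 3, the two
    neighbours of a vertex are distinct from each other and from it. *)
Lemma signed_wheel_distance_rim i j : (3 <= n)%N ->
  signed_wheel_distance (lift ord0 i) (lift ord0 j)
    = 2 - 2 * (i == j)%:R - 3 * ((i == ordS j)%:R + (i == ord_pred j)%:R).
Proof.
move=> hn; rewrite /signed_wheel_distance (inj_eq lift_inj).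
rewrite /rim_edge !liftK /spoke /= /cycle_adj.
have -> : (j == ordS i) = (i == ord_pred j).
  by rewrite -[RHS](inj_eq (@ordS_inj n)) ord_predK eq_sym.
have -> : (i == ord_pred j) = (ordS i == j).
  by rewrite -[LHS](inj_eq (@ordS_inj n)) ord_predK.
have ordS_val (k : 'I_n) : nat_of_ord (ordS k) = if k.+1 == n then 0%N else k.+1.
  rewrite /=; have [->|kn] := eqVneq; first by rewrite modnn.
  by rewrite modn_small// ltn_neqAle kn ltn_ord.
rewrite -!val_eqE /= -![(_ %% n)%N]/(nat_of_ord (ordS _)) !ordS_val.
have := ltn_ord i; have := ltn_ord j => lj li.
have natbE (b : bool) : b%:R = (if b then 1 else 0) :> int by case: b.
rewrite !natbE.
by case: (eqVneq j.+1 n) => ?; case: (eqVneq i.+1 n) => ?; do ![case: ifP => ?]; lia.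
Qed.

End WheelDistance.

(** * Trigonometric sums over a full period *)

Section TrigonometricSums.
Variables (R : realType) (n : nat).

Lemma sum_shift (f : nat -> R) :
  \sum_(k < n) f k.+1 = \sum_(k < n) f k + (f n - f 0).
Proof.
have : \sum_(k < n.+1) f k = f 0 + \sum_(k < n) f k.+1 by rewrite big_ord_recl.
by rewrite big_ord_recr /= => /(canRL (addKr _)) ->; ring.
Qed.

(** The pair (sum of cosines, sum of sines) is unchanged by the shift k -> k+1,
    which acts on it as the rotation of angle a. A rotation other than the
    identity fixes only the zero vector. *)
Lemma sum_cos_sin_eq0 (a : R) : cos (n%:R * a) = 1 -> cos a != 1 ->
  \sum_(k < n) cos (k%:R * a) = 0 /\ \sum_(k < n) sin (k%:R * a) = 0.
Proof.
move=> cna ca1; have sna : sin (n%:R * a) = 0.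
  by apply: cos1sin0; rewrite cna normr1.
have := sum_shift (fun k => cos (k%:R * a)).
have := sum_shift (fun k => sin (k%:R * a)).
rewrite cna sna !mul0r cos0 sin0 !subrr !addr0.
under eq_bigr do rewrite -natr1 mulrDl mul1r sinD.
rewrite big_split /= -!mulr_suml => eS.
under eq_bigr do rewrite -natr1 mulrDl mul1r cosD.
rewrite big_split /= sumrN -!mulr_suml => eC.
move: eS eC; set S := \sum_(k < n) sin _; set C := \sum_(k < n) cos _ => eS eC.
have := cos2Dsin2 a; move: (cos a) (sin a) ca1 eS eC => c s c1 eS eC cs.
have c1' : 1 - c != 0 by rewrite subr_eq0 eq_sym.
(* Apply the adjugate of (rotation - identity), whose determinant is
   2 (1 - c) since c^2 + s^2 = 1. *)
have eC0 : (1 - c) * C = 0.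
  have -> : (1 - c) * C = 1/2 * ((C * c - S * s - C) * (c - 1)
     + (S * c + C * s - S) * s + C * (1 - (c^+2 + s ^+2))) by field.
  by rewrite eC eS cs; ring.
have eS0 : (1 - c) * S = 0.
  have -> : (1 - c) * S = 1/2 * ((S * c + C * s - S) * (c - 1)
     - (C * c - S * s - C) * s + S * (1 - (c^+2 + s ^+2))) by field.
  by rewrite eC eS cs; ring.
by split; apply: (mulfI c1'); rewrite mulr0.
Qed.

(** Unlike the cosines, the sines cancel even when a is a multiple of 2 pi,
    since each of them is then zero. *)
Lemma sum_sin_eq0 (a : R) : cos (n%:R * a) = 1 ->
  \sum_(k < n) sin (k%:R * a) = 0.
Proof.
move=> cna; have [ca1|/(sum_cos_sin_eq0 a cna)[]//] := eqVneq (cos a) 1.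
have sa : sin a = 0 by apply: cos1sin0; rewrite ca1 normr1.
apply: big1 => k _; elim: (nat_of_ord k) => [|m IH]; first by rewrite mul0r sin0.
by rewrite -natr1 mulrDl mul1r sinD IH sa mul0r mulr0 addr0.
Qed.

Lemma cos_neq1_lt2pi (x : R) : 0 < x < 2 * pi -> cos x != 1.
Proof.
move=> /andP[x0 x2pi]; have -> : x = (x / 2) *+ 2 by rewrite -mulr_natr; field.
have s0 : 0 < sin (x / 2) by apply: sin_gt0_pi; rewrite divr_gt0//=; lra.
rewrite cos_mulr2n cos2sin2; apply/eqP => e.
have : 0 < sin (x / 2) ^+ 2 by rewrite exprn_gt0.
by rewrite -mulr_natr in e; lra.
Qed.

End TrigonometricSums.

(** * The Hartley basis *)

Section Hartley.
Variables (R : realType) (n : nat).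
Hypothesis n_gt0 : (0 < n)%N.
Implicit Types (j l k : nat).

Definition harmonic_angle j : R := 2 * j%:R * pi / n%:R.

(** The kernel of the Hartley transform, a real substitute for the
    exponential exp(i x). *)
Definition cas (x : R) : R := cos x + sin x.

Lemma cas_add_sub x y : cas (x + y) + cas (x - y) = 2 * cos y * cas x.
Proof. by rewrite /cas cosD sinD cosB sinB; ring. Qed.

Lemma casM x y : cas x * cas y = cos (x - y) + sin (x + y).
Proof. by rewrite /cas cosB sinD; ring. Qed.

Lemma natr_n_neq0 : n%:R != 0 :> R.
Proof. by rewrite pnatr_eq0 -lt0n. Qed.

Lemma period_angle j : n%:R * harmonic_angle j = (pi *+ 2) *+ j.
Proof.
rewrite /harmonic_angle mulrC divfK ?natr_n_neq0// -[RHS]mulr_natr mulr2n.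
by ring.
Qed.

Lemma cas_periodic j x : cas (x + n%:R * harmonic_angle j) = cas x.
Proof.
by rewrite period_angle /cas (periodicn (@cosD2pi R)) (periodicn (@sinD2pi R)).
Qed.

Lemma cos_period_angle j : cos (n%:R * harmonic_angle j) = 1.
Proof. by rewrite -[X in cos X]add0r period_angle (periodicn (@cosD2pi R)) cos0. Qed.

Lemma sin_period_angle j : sin (n%:R * harmonic_angle j) = 0.
Proof. by apply: cos1sin0; rewrite cos_period_angle normr1. Qed.

Lemma cas_modn j k : cas ((k %% n)%:R * harmonic_angle j) = cas (k%:R * harmonic_angle j).
Proof.
rewrite [in RHS](divn_eq k n) natrD natrM.
elim: (k %/ n)%N => [|q IH]; first by rewrite mul0r add0r.
rewrite {}IH -[in RHS]natr1 -[in LHS](cas_periodic j); congr (cas _); ring.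
Qed.

Definition hartley_row j (k : 'I_n) : R := cas (k%:R * harmonic_angle j).

Lemma hartley_row0 (k : 'I_n) : hartley_row 0 k = 1.
Proof.
by rewrite /hartley_row /harmonic_angle !(mulr0, mul0r) /cas cos0 sin0 addr0.
Qed.

(** The Hartley rows are eigenvectors of the adjacency operator of the cycle,
    by the addition formula [cas_add_sub]; periodicity absorbs the wrap-around
    at the ends. *)
Lemma hartley_row_neighbors j (k : 'I_n) :
  hartley_row j (ordS k) + hartley_row j (ord_pred k)
    = 2 * cos (harmonic_angle j) * hartley_row j k.
Proof.
rewrite /hartley_row !cas_modn -cas_add_sub -natr1 mulrDl mul1r; congr (_ + _).
rewrite -[RHS](cas_periodic j) -subn1 natrB ?addn_gt0 ?n_gt0 ?orbT// natrD.
by congr (cas _); ring.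
Qed.

(** By [casM], the inner product is a sum of cosines of multiples of the
    difference of the two angles plus a sum of sines of multiples of their sum.
    The sines always cancel over a period; the cosines cancel unless j = l. *)
Lemma hartley_orthogonal j l : (j < n)%N -> (l < n)%N ->
  \sum_(k < n) hartley_row j k * hartley_row l k = n%:R * (j == l)%:R.
Proof.
move=> jn ln.
under eq_bigr do rewrite /hartley_row casM -mulrBr -mulrDr.
rewrite big_split /= [X in _ + X]sum_sin_eq0 ?addr0; last first.
  by rewrite mulrDr cosD !cos_period_angle !sin_period_angle; ring.
have cos_sum i m : (i < m < n)%N ->
  \sum_(k < n) cos (k%:R * (harmonic_angle m - harmonic_angle i)) = 0.
  move=> /andP[im mn]; apply: (sum_cos_sin_eq0 R n _ _ _).1.
    by rewrite mulrBr cosB !cos_period_angle !sin_period_angle; ring.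
  have -> : harmonic_angle m - harmonic_angle i = 2 * pi * ((m - i)%:R / n%:R).
    by rewrite /harmonic_angle natrB 1?ltnW//; ring.
  have n0 : 0 < n%:R :> R by rewrite ltr0n.
  have twopi0 : 0 < 2 * pi :> R by rewrite mulr_gt0// pi_gt0.
  apply: cos_neq1_lt2pi; rewrite pmulr_rgt0// divr_gt0 ?ltr0n ?subn_gt0//=.
  rewrite gtr_pMr// ltr_pdivrMr// mul1r ltr_nat.
  exact: leq_ltn_trans (leq_subr _ _) mn.
case: ltngtP => [jl|lj|->].
- rewrite mulr0 -[RHS](cos_sum j l) ?jl ?ln//; apply: eq_bigr => k _.
  by rewrite -cosN -mulrN opprB.
- by rewrite mulr0 cos_sum ?lj ?jn.
- by under eq_bigr do rewrite subrr mulr0 cos0; rewrite sumr_const card_ord mulr1.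
Qed.

End Hartley.

(** * Eigenvectors of the signed wheel *)

Section WheelEigenrows.
Variables (R : realType) (n : nat).
Hypothesis n_ge3 : (3 <= n)%N.
Variables lp lm : R.
Hypothesis root_sum : lp + lm = 2 * n%:R - 8.
Hypothesis root_prod : lp * lm = - n%:R.
Implicit Type u : nat.

Let n_gt0 : (0 < n)%N. Proof. exact: leq_trans n_ge3. Qed.

(** The eigenrow of index u is (eigen_hub u, eigen_rim u * v_(u.-1)). Indices 0
    and 1 both use the constant vector v_0: they are the two eigenvectors of the
    plane spanned by the hub and the all-ones vector of the rim. *)
Definition eigen_hub u : R := if (u <= 1)%N then n%:R else 0.

Definition eigen_rim u : R :=
  if u == 0%N then lp else if u == 1%N then lm else 1.

Definition wheel_eigenvalue u : R :=
  if u == 0%N then lp else if u == 1%N then lm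
  else - 2 - 6 * cos (harmonic_angle R n u.-1).

Definition wheel_eigenrows : 'M[R]_n.+1 :=
  \matrix_(u, w) if unlift ord0 w is Some k
                 then eigen_rim u * hartley_row R n u.-1 k else eigen_hub u.

Lemma wheel_eigenrows_hub (u : 'I_n.+1) : wheel_eigenrows u ord0 = eigen_hub u.
Proof. by rewrite mxE unlift_none. Qed.

Lemma wheel_eigenrows_rim (u : 'I_n.+1) (k : 'I_n) :
  wheel_eigenrows u (lift ord0 k) = eigen_rim u * hartley_row R n u.-1 k.
Proof. by rewrite mxE liftK. Qed.

Lemma root_eq (x : R) : (x == lp) || (x == lm) ->
  x ^+ 2 = (2 * n%:R - 8) * x + n%:R.
Proof.
rewrite -root_sum -[n%:R]opprK -root_prod => /orP[]/eqP->; ring.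
Qed.

Lemma sum_hartley_row j : (j < n)%N ->
  \sum_(k < n) hartley_row R n j k = n%:R * (j == 0%N)%:R.
Proof.
move=> jn; rewrite -(@hartley_orthogonal R n n_gt0 j 0 jn n_gt0).
by apply: eq_bigr => k _; rewrite hartley_row0 mulr1.
Qed.

(** The action of 2 J - 2 I - 3 A on a function of the rim. *)
Lemma sum_rim_column (f : 'I_n -> R) (k : 'I_n) :
  \sum_(i < n) f i * (signed_wheel_distance n (lift ord0 i) (lift ord0 k))%:~R
  = 2 * (\sum_(i < n) f i) - 2 * f k - 3 * (f (ordS k) + f (ord_pred k)).
Proof.
have pick (l : 'I_n) : \sum_(i < n) f i * (i == l)%:R = f l.
  rewrite (bigD1 l)//= eqxx mulr1 big1 ?addr0// => i /negPf->.
  by rewrite mulr0.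
rewrite -(pick k) -(pick (ordS k)) -(pick (ord_pred k)) -big_split/=.
rewrite !mulr_sumr -!sumrB; apply: eq_bigr => i _.
rewrite signed_wheel_distance_rim//.
by do 3 case: (_ == _); rewrite /=; ring.
Qed.

(** For the rows 0 and 1 the hub column of the identity says that the
    eigenvalue is the rim amplitude, and the rim columns are the quadratic
    equation [root_eq]. For the other rows the terms coming from the hub and
    from J vanish. *)
Lemma wheel_eigenrowsM :
  wheel_eigenrows *m Dpm R (signed_wheel n)
    = diag_mx (\row_u wheel_eigenvalue u) *m wheel_eigenrows.
Proof.
have DE (u w : 'I_n.+1) : Dpm R (signed_wheel n) u w = (signed_wheel_distance n u w)%:~R.
  by rewrite mxE (wheel_signed_distance _ u w).1.
have lp2 : lp ^+ 2 = (2 * n%:R - 8) * lp + n%:R by apply: root_eq; rewrite eqxx.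
have lm2 : lm ^+ 2 = (2 * n%:R - 8) * lm + n%:R.
  by apply: root_eq; rewrite eqxx orbT.
apply/matrixP => u w; rewrite mul_diag_mx [LHS]mxE [RHS]mxE mxE big_ord_recl.
have un : (u.-1 < n)%N by have := ltn_ord u; lia.
rewrite DE wheel_eigenrows_hub.
under eq_bigr do rewrite DE wheel_eigenrows_rim.
have [k ->|->] := unliftP ord0 w; last first.
  rewrite wheel_eigenrows_hub {1}/signed_wheel_distance eqxx mulr0 add0r.
  under eq_bigr do rewrite signed_wheel_distance_rim_hub mulr1.
  rewrite -mulr_sumr sum_hartley_row// /eigen_rim /eigen_hub /wheel_eigenvalue.
  by case: (nat_of_ord u) => [|[|j]] /=; ring.
rewrite wheel_eigenrows_rim signed_wheel_distance_hub_rim mulr1 sum_rim_column.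
rewrite -mulr_sumr sum_hartley_row// -mulrDr hartley_row_neighbors//.
rewrite /eigen_rim /eigen_hub /wheel_eigenvalue.
case: (nat_of_ord u) => [|[|j]] /=; rewrite ?hartley_row0; last by ring.
- by rewrite /harmonic_angle mulr0 !mul0r cos0 mulr1 -expr2 lp2; ring.
- by rewrite /harmonic_angle mulr0 !mul0r cos0 mulr1 -expr2 lm2; ring.
Qed.

Lemma wheel_eigenrows_gram (u w : 'I_n.+1) :
  (wheel_eigenrows *m wheel_eigenrows^T) u w
  = eigen_hub u * eigen_hub w
    + eigen_rim u * eigen_rim w * (n%:R * (u.-1 == w.-1)%:R).
Proof.
rewrite mxE; under eq_bigr do rewrite [_^T _ _]mxE.
rewrite big_ord_recl !wheel_eigenrows_hub; congr (_ + _).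
under eq_bigr do rewrite !wheel_eigenrows_rim mulrACA.
rewrite -mulr_sumr hartley_orthogonal//.
  by have := ltn_ord u; lia.
by have := ltn_ord w; lia.
Qed.

(** Orthogonality of the Hartley rows leaves only the pair (0, 1), whose
    inner product n^2 + n lp lm is zero by [root_prod]. *)
Lemma wheel_eigenrows_orthogonal (u w : 'I_n.+1) : u != w ->
  (wheel_eigenrows *m wheel_eigenrows^T) u w = 0.
Proof.
rewrite wheel_eigenrows_gram -val_eqE /=.
case: (nat_of_ord u) (nat_of_ord w) => [|[|j]] [|[|l]]//=;
  rewrite /eigen_hub /eigen_rim /= ?eqSS.
- by rewrite root_prod => _; ring.
- by move=> _; ring.
- by rewrite [lm * lp]mulrC root_prod => _; ring.
- by move=> _; ring.
- by move=> _; ring.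
- by move=> _; ring.
- by move=> /negPf->; rewrite !mulr0 addr0.
Qed.

Lemma wheel_eigenrows_norm_neq0 (u : 'I_n.+1) :
  (wheel_eigenrows *m wheel_eigenrows^T) u u != 0.
Proof.
have n0 : 0 < n%:R :> R by rewrite ltr0n.
rewrite wheel_eigenrows_gram eqxx mulr1 -!expr2 /eigen_hub /eigen_rim gt_eqF//.
case: (nat_of_ord u) => [|[|j]] /=; last by rewrite expr0n expr1n add0r mul1r.
- by rewrite ltr_wpDr ?exprn_gt0// mulr_ge0 ?sqr_ge0 ?ler0n.
- by rewrite ltr_wpDr ?exprn_gt0// mulr_ge0 ?sqr_ge0 ?ler0n.
Qed.

Lemma char_poly_signed_wheel :
  char_poly (Dpm R (signed_wheel n))
    = \prod_(u < n.+1) ('X - (wheel_eigenvalue u)%:P).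
Proof.
rewrite (char_poly_orthogonal_eigenrows _ _ _ _ _ wheel_eigenrowsM
  wheel_eigenrows_orthogonal wheel_eigenrows_norm_neq0).
by apply: eq_bigr => u _; rewrite mxE.
Qed.

End WheelEigenrows.

Theorem theorem4p3 (R : realType) (n : nat) (hn : (3 <= n)%N) (hodd : odd n) :
  Dmax R (signed_wheel n) = Dmin R (signed_wheel n) /\
  has_spectrum (Dpm R (signed_wheel n))
    [:: n%:R - 4 + Num.sqrt (n%:R ^+ 2 - 7 * n%:R + 16),
        n%:R - 4 - Num.sqrt (n%:R ^+ 2 - 7 * n%:R + 16)
      & [seq - 2 - 6 * cos (2 * j%:R * pi / n%:R) | j <- iota 1 n.-1]].
Proof.
split.
  apply/matrixP => u v; rewrite !mxE.
  by have [-> ->] := wheel_signed_distance n u v.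
rewrite /has_spectrum; set r := Num.sqrt _.
have r2 : r ^+ 2 = n%:R ^+ 2 - 7 * n%:R + 16.
  (* The radicand is (n - 7/2)^2 + 15/4. *)
  by rewrite sqr_sqrtr//; have := sqr_ge0 (n%:R - 7 / 2 : R); lra.
rewrite (@char_poly_signed_wheel _ _ hn (n%:R - 4 + r) (n%:R - 4 - r)).
- clearbody r; case: n hn {hodd r2} => // m _.
  rewrite 2!big_ord_recl 2!big_cons big_map; congr (_ * (_ * _)).
  rewrite -[iota 1 m]/(iota (1 + 0) m) iotaDl big_map.
  by rewrite -[m in iota _ m]subn0 big_mkord.
- by ring.
- have -> : (n%:R - 4 + r) * (n%:R - 4 - r) = (n%:R - 4) ^+ 2 - r ^+ 2 by ring.
  by rewrite r2; ring.
Qed.
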